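(* Let the floating-point precision be $p=53$ (double precision). Let $x$ be a floating-point number of precision $53$ and let $n$ be an integer with $1\le n\le 2^{49}$. Let $(h,l)$ be the pair returned by the algorithm $\mathrm{LogPower}(x,n)$, with all operations executed in precision $53$. Then $\mathrm{RN}(h+l)$ is a faithful rounding of $x^n$.
   Context: **Floating-point setting.** Radix-2 floating-point arithmetic of precision $p$ (significands of $p$ bits), following IEEE-754, with rounding to nearest: $\mathrm{RN}(z)$ is the precision-$p$ floating-point number closest to the real number $z$; if $z$ is exactly midway between two consecutive floating-point numbers, the one whose last significand bit is zero is chosen. Each operation is correctly rounded, and a fused multiply-add is available, i.e. $\mathrm{RN}(ab\pm c)$ is computed with a single rounding. Inputs and outputs are assumed not to be subnormal and to be below the overflow threshold, so that only significands matter; underflow and overflow are disregarded (the exponent range is treated as unbounded). **Faithful rounding.** A floating-point number $y$ is a faithful rounding of a real number $z$ if $y\in\{\mathrm{RD}(z),\mathrm{RU}(z)\}$, where $\mathrm{RD}(z)$ is the largest floating-point number $\le z$ and $\mathrm{RU}(z)$ is the smallest floating-point number $\ge z$. **Algorithms.** All variables are floating-point numbers, except the integers $i,n$. - $\mathrm{Fast2Sum}(a,b)$: $s:=\mathrm{RN}(a+b)$; $z:=\mathrm{RN}(s-a)$; $t:=\mathrm{RN}(b-z)$; return $(s,t)$. - $\mathrm{Fast2Mult}(a,b)$: $c:=\mathrm{RN}(ab)$; $d:=\mathrm{RN}(ab-c)$; return $(c,d)$. - $\mathrm{DblMult}(a_h,a_l,b_h,b_l)$: $t:=\mathrm{RN}(a_l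 b_h)$; $s:=\mathrm{RN}(a_h b_l+t)$ (a single fma); $(x',u):=\mathrm{Fast2Mult}(a_h,b_h)$; $(x'',v):=\mathrm{Fast2Sum}(x',s)$; $y':=\mathrm{RN}(u+v)$; $(x,y):=\mathrm{Fast2Sum}(x'',y')$; return $(x,y)$. - $\mathrm{LogPower}(x,n)$, for an integer $n\ge1$: $i:=n$; $(h,l):=(1,0)$; $(u,v):=(x,0)$; while $i>1$ do: [if $i \bmod 2=1$ then $(h,l):=\mathrm{DblMult}(h,l,u,v)$; then $(u,v):=\mathrm{DblMult}(u,v,u,v)$; $i:=\lfloor i/2\rfloor$]; after the loop, return $\mathrm{DblMult}(h,l,u,v)$. The returned pair is denoted $(h,l)$. *)

(* Defs.v *)
From Stdlib Require Import Reals ZArith Lra Lia Psatz Classical ClassicalEpsilon.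

Open Scope R_scope.

(* Radix 2, precision [p], unbounded exponent range: no underflow, no overflow,
   no subnormals. *)
Definition is_float (p : Z) (y : R) : Prop :=
  exists m e : Z, (Z.abs m < 2 ^ p)%Z /\ y = IZR m * powerRZ 2 e.

(* The parity of the last significand bit only makes sense for the normalized
   (p-bit) significand, hence the lower bound on [Z.abs m]. *)
Definition last_bit_zero (p : Z) (y : R) : Prop :=
  exists m e : Z, (2 ^ (p - 1) <= Z.abs m < 2 ^ p)%Z /\ Z.Even m /\
    y = IZR m * powerRZ 2 e.

Definition is_RN (p : Z) (z y : R) : Prop :=
  is_float p y /\
  (forall f, is_float p f -> Rabs (z - y) <= Rabs (z - f)) /\
  (forall f, is_float p f -> f <> y -> Rabs (z - f) = Rabs (z - y) ->
     last_bit_zero p y).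

(* By [RN_spec] and [is_RN_unique] below, this is the unique real satisfying
   [is_RN p z] as soon as [2 <= p]. *)
Definition RN (p : Z) (z : R) : R := epsilon (inhabits 0) (is_RN p z).

Definition is_RD (p : Z) (z y : R) : Prop :=
  is_float p y /\ y <= z /\ forall f, is_float p f -> f <= z -> f <= y.

Definition is_RU (p : Z) (z y : R) : Prop :=
  is_float p y /\ z <= y /\ forall f, is_float p f -> z <= f -> y <= f.

Definition faithful (p : Z) (z y : R) : Prop := is_RD p z y \/ is_RU p z y.

Definition Fast2Sum (p : Z) (a b : R) : R * R :=
  let s := RN p (a + b) in
  let z := RN p (s - a) in
  let t := RN p (b - z) in
  (s, t).

Definition Fast2Mult (p : Z) (a b : R) : R * R :=
  let c := RN p (a * b) in
  let d := RN p (a * b - c) in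
  (c, d).

Definition DblMult (p : Z) (ah al bh bl : R) : R * R :=
  let t := RN p (al * bh) in
  let s := RN p (ah * bl + t) in
  let (x', u) := Fast2Mult p ah bh in
  let (x'', v) := Fast2Sum p x' s in
  let y' := RN p (u + v) in
  Fast2Sum p x'' y'.

(* The while loop followed by the final product.  The loop test and the
   operations on [i] are read off its binary representation: [xH] is i = 1,
   [xI j] is i odd with floor (i / 2) = j, and [xO j] is i even with i / 2 = j;
   see [LogPower_loop_step]. *)
Fixpoint LogPower_loop (p : Z) (i : positive) (h l u v : R) : R * R :=
  match i with
  | xH => DblMult p h l u v
  | xO j =>
      let (u', v') := DblMult p u v u v in
      LogPower_loop p j h l u' v'
  | xI j =>
      let (h', l') := DblMult p h l u v in
      let (u', v') := DblMult p u v u v in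
      LogPower_loop p j h' l' u' v'
  end.

(* Only meaningful for 1 <= n. *)
Definition LogPower (p : Z) (x : R) (n : Z) : R * R :=
  LogPower_loop p (Z.to_pos n) 1 0 x 0.

Lemma LogPower_loop_step (p i : Z) (h l u v : R) : (1 < i)%Z ->
  LogPower_loop p (Z.to_pos i) h l u v =
  let (h', l') := if (i mod 2 =? 1)%Z then DblMult p h l u v else (h, l) in
  let (u', v') := DblMult p u v u v in
  LogPower_loop p (Z.to_pos (i / 2)) h' l' u' v'.
Proof.
intros Hi.
destruct i as [|i|i]; try lia.
destruct i as [j|j|]; try lia; cbn [Z.to_pos].
- replace (Z.pos j~1 mod 2)%Z with 1%Z
    by (apply (Z.mod_unique_pos _ _ (Z.pos j)); lia).
  replace (Z.pos j~1 / 2)%Z with (Z.pos j)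
    by (apply (Z.div_unique_pos _ _ _ 1); lia).
  reflexivity.
- replace (Z.pos j~0 mod 2)%Z with 0%Z
    by (apply (Z.mod_unique_pos _ _ (Z.pos j)); lia).
  replace (Z.pos j~0 / 2)%Z with (Z.pos j)
    by (apply (Z.div_unique_pos _ _ _ 0); lia).
  reflexivity.
Qed.

Lemma pow2_gt0 (e : Z) : 0 < powerRZ 2 e.
Proof. apply powerRZ_lt; lra. Qed.

Lemma pow2_add (a b : Z) : powerRZ 2 (a + b) = powerRZ 2 a * powerRZ 2 b.
Proof. apply powerRZ_add; lra. Qed.

Lemma pow2_IZR (a : Z) : (0 <= a)%Z -> powerRZ 2 a = IZR (2 ^ a).
Proof.
intros Ha.
rewrite <- (Z2Nat.id a Ha), <- pow_powerRZ, <- pow_IZR.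
reflexivity.
Qed.

Lemma pow2_le (a b : Z) : (a <= b)%Z -> powerRZ 2 a <= powerRZ 2 b.
Proof.
intros H.
replace b with (a + (b - a))%Z by lia.
rewrite pow2_add, (pow2_IZR (b - a)) by lia.
assert (1 <= 2 ^ (b - a))%Z by (apply (Z.pow_le_mono_r 2 0); lia).
assert (1 <= IZR (2 ^ (b - a))) by (apply IZR_le; assumption).
generalize (pow2_gt0 a); nra.
Qed.


Lemma binade_exists (z : R) : z <> 0 ->
  exists k : Z, powerRZ 2 k <= Rabs z < powerRZ 2 (k + 1).
Proof.
intros Hz.
pose proof (Rabs_pos_lt z Hz) as Hpos.
assert (Hl2 : 0 < ln 2) by (rewrite <- ln_1; apply ln_increasing; lra).
set (w := ln (Rabs z) / ln 2).
assert (Hw : Rabs z = Rpower 2 w).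
{ unfold Rpower, w.
  replace (ln (Rabs z) / ln 2 * ln 2) with (ln (Rabs z)) by (field; lra).
  symmetry; apply exp_ln; assumption. }
destruct (base_Int_part w) as [H1 H2].
exists (Int_part w).
rewrite !powerRZ_Rpower by lra.
rewrite Hw; split.
- apply Rle_Rpower; lra.
- apply Rpower_lt; [lra|]. rewrite plus_IZR; lra.
Qed.

(* Round half to even on the integers. *)
Lemma nearest_even_int (t : R) : exists n : Z,
  (forall k : Z, Rabs (t - IZR n) <= Rabs (t - IZR k)) /\
  (forall k : Z, k <> n -> Rabs (t - IZR k) = Rabs (t - IZR n) -> Z.Even n).
Proof.
destruct (base_Int_part t) as [H1 H2].
set (m := Int_part t) in *.
assert (Hk : forall k : Z, IZR k <= IZR m \/ IZR m + 1 <= IZR k).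
{ intros k; destruct (Z_le_gt_dec k m) as [H|H].
  - left; apply IZR_le; assumption.
  - right; rewrite <- plus_IZR; apply IZR_le; lia. }
assert (Hcase : t - IZR m < 1 / 2 \/ (t - IZR m = 1 / 2 /\ Z.Even m) \/
   (t - IZR m = 1 / 2 /\ Z.Even (m + 1)) \/ 1 / 2 < t - IZR m).
{ destruct (Rtotal_order (t - IZR m) (1 / 2)) as [H|[H|H]]; auto.
  destruct (Z.Even_or_Odd m) as [E|[q E]]; auto.
  right; right; left; split; [assumption|]. exists (q + 1)%Z; lia. }
assert (Hlow : t - IZR m < 1 / 2 \/ (t - IZR m = 1 / 2 /\ Z.Even m) ->
  exists n : Z, (forall k : Z, Rabs (t - IZR n) <= Rabs (t - IZR k)) /\
  (forall k : Z, k <> n -> Rabs (t - IZR k) = Rabs (t - IZR n) -> Z.Even n)).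
{ intros Hc; exists m; split.
  - intros k; destruct (Hk k); unfold Rabs; repeat destruct Rcase_abs; lra.
  - intros k Hkm Heq; destruct Hc as [Hc|[_ Hc]]; [exfalso|assumption].
    apply Hkm, eq_IZR; revert Heq.
    destruct (Hk k); unfold Rabs; repeat destruct Rcase_abs; lra. }
assert (Hupp : 1 / 2 < t - IZR m \/ (t - IZR m = 1 / 2 /\ Z.Even (m + 1)) ->
  exists n : Z, (forall k : Z, Rabs (t - IZR n) <= Rabs (t - IZR k)) /\
  (forall k : Z, k <> n -> Rabs (t - IZR k) = Rabs (t - IZR n) -> Z.Even n)).
{ intros Hc; exists (m + 1)%Z; rewrite plus_IZR; split.
  - intros k; destruct (Hk k); unfold Rabs; repeat destruct Rcase_abs; lra.
  - intros k Hkm Heq; destruct Hc as [Hc|[_ Hc]]; [exfalso|assumption].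
    apply Hkm, eq_IZR; rewrite plus_IZR; revert Heq.
    destruct (Hk k); unfold Rabs; repeat destruct Rcase_abs; lra. }
destruct Hcase as [H|[H|[H|H]]]; auto.
Qed.

Lemma RN_exists (p : Z) (z : R) : (2 <= p)%Z -> exists y, is_RN p z y.
Proof.
intros Hp.
destruct (Req_dec z 0) as [->|Hz].
{ exists 0; split; [|split].
  - exists 0%Z, 0%Z; split; [|simpl; ring].
    change (Z.abs 0) with 0%Z; apply Z.pow_pos_nonneg; lia.
  - intros f _; rewrite Rminus_0_r, Rabs_R0; apply Rabs_pos.
  - intros f _ Hf Heq; exfalso; apply Hf.
    rewrite Rminus_0_r, Rabs_R0 in Heq.
    generalize (Rabs_pos_lt (0 - f)); intros Hx.
    destruct (Req_dec f 0) as [|Hf0]; [assumption|].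
    assert (0 - f <> 0) by lra. specialize (Hx H); lra. }
destruct (binade_exists z Hz) as [k [Hk1 Hk2]].
set (e := (k - p + 1)%Z).
set (N := (2 ^ (p - 1))%Z).
assert (HN2 : (2 ^ p = 2 * N)%Z).
{ unfold N; replace p with (Z.succ (p - 1)) at 1 by lia.
  rewrite Z.pow_succ_r by lia; reflexivity. }
assert (HN0 : (2 <= N)%Z) by (apply (Z.pow_le_mono_r 2 1); lia).
assert (HNE : Z.Even N).
{ unfold N; replace (p - 1)%Z with (Z.succ (p - 2)) by lia.
  rewrite Z.pow_succ_r by lia; eexists; reflexivity. }
set (B := powerRZ 2 e).
assert (HB : 0 < B) by apply pow2_gt0.
assert (HNB : powerRZ 2 k = IZR N * B).
{ unfold N, B; rewrite <- pow2_IZR, <- pow2_add by lia.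
  f_equal; unfold e; lia. }
assert (HNB2 : powerRZ 2 (k + 1) = 2 * (IZR N * B)).
{ rewrite pow2_add, HNB; simpl; ring. }
rewrite HNB in Hk1; rewrite HNB2 in Hk2; clear HNB HNB2.
set (t := z / B).
assert (Ht : z = t * B) by (unfold t; field; lra).
assert (Habs : forall a, Rabs (a * B) = Rabs a * B).
{ intros a; rewrite Rabs_mult, (Rabs_pos_eq B) by lra; reflexivity. }
assert (HNR : 2 <= IZR N) by (apply IZR_le; assumption).
assert (Ht1 : IZR N <= Rabs t /\ Rabs t < 2 * IZR N).
{ rewrite Ht, Habs in Hk1, Hk2; split; nra. }
destruct Ht1 as [Ht1 Ht2].
destruct (nearest_even_int t) as [n [Hn1 Hn2]].
assert (HnN : (N <= Z.abs n <= 2 * N)%Z).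
{ pose proof (Hn1 N) as A1; pose proof (Hn1 (- N)%Z) as A2.
  pose proof (Hn1 (2 * N)%Z) as A3; pose proof (Hn1 (- (2 * N))%Z) as A4.
  rewrite ?opp_IZR, ?mult_IZR in *.
  assert (IZR N <= Rabs (IZR n) /\ Rabs (IZR n) <= 2 * IZR N).
  { revert A1 A2 A3 A4 Ht1 Ht2; unfold Rabs; repeat destruct Rcase_abs; lra. }
  split; apply le_IZR; rewrite abs_IZR, ?mult_IZR; lra. }
assert (Hfl : forall f, is_float p f ->
  (exists j : Z, f = IZR j * B) \/ Rabs f < IZR N * B).
{ intros f [M [E [HM ->]]].
  destruct (Z_le_gt_dec e E) as [HE|HE].
  - left; exists (M * 2 ^ (E - e))%Z.
    rewrite mult_IZR, <- pow2_IZR by lia; unfold B.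
    rewrite Rmult_assoc, <- pow2_add; do 2 f_equal; lia.
  - right; rewrite Rabs_mult, (Rabs_pos_eq (powerRZ 2 E)), <- abs_IZR
      by (apply Rlt_le, pow2_gt0).
    assert (HB2 : 2 * powerRZ 2 E <= B).
    { replace 2 with (powerRZ 2 1) at 1 by (simpl; ring).
      rewrite <- pow2_add; apply pow2_le; lia. }
    assert (IZR (Z.abs M) < 2 * IZR N)
      by (rewrite <- mult_IZR; apply IZR_lt; lia).
    generalize (pow2_gt0 E); nra. }
assert (Hz_n : forall j : Z, Rabs (z - IZR j * B) = Rabs (t - IZR j) * B).
{ intros j; rewrite Ht, <- Habs; f_equal; ring. }
assert (Hsmall : forall f, Rabs f < IZR N * B ->
  Rabs (z - IZR n * B) < Rabs (z - f)).
{ intros f Hf.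
  pose proof (Hn1 N) as A1; pose proof (Hn1 (- N)%Z) as A2.
  apply (Rmult_le_compat_r B) in A1; [|lra].
  apply (Rmult_le_compat_r B) in A2; [|lra].
  rewrite <- !Hz_n in A1, A2; rewrite opp_IZR in A2.
  replace (- IZR N * B) with (- (IZR N * B)) in A2 by ring.
  assert (Rabs (z - IZR N * B) < Rabs (z - f) \/
          Rabs (z - - (IZR N * B)) < Rabs (z - f)).
  { assert (0 < IZR N * B) by nra.
    clear - Hf Hk1 H; revert Hf Hk1; generalize dependent (IZR N * B).
    intros c; unfold Rabs; repeat destruct Rcase_abs; intros; lra. }
  lra. }
exists (IZR n * B); split; [|split].
- destruct (Z.eq_dec (Z.abs n) (2 * N)) as [Hn|Hn].
  + exists (Z.sgn n), (e + p)%Z; split; [lia|].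
    replace n with (2 ^ p * Z.sgn n)%Z at 1
      by (rewrite HN2, <- Hn; apply Z.abs_sgn).
    rewrite mult_IZR, pow2_add, (pow2_IZR p) by lia; unfold B; ring.
  + exists n, e; split; [lia|reflexivity].
- intros f Hf; destruct (Hfl f Hf) as [[j ->]|Hs].
  + rewrite !Hz_n; apply Rmult_le_compat_r; [lra|apply Hn1].
  + apply Rlt_le, Hsmall, Hs.
- intros f Hf Hne Heq; destruct (Hfl f Hf) as [[j ->]|Hs].
  + assert (Z.Even n) as Hev.
    { apply (Hn2 j).
      - intros ->; apply Hne; reflexivity.
      - rewrite !Hz_n in Heq; apply Rmult_eq_reg_r in Heq; [assumption|lra]. }
    destruct (Z.eq_dec (Z.abs n) (2 * N)) as [Hn|Hn].
    * exists (N * Z.sgn n)%Z, (e + 1)%Z; split; [|split].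
      { fold N; rewrite HN2; lia. }
      { destruct HNE as [q ->]; exists (q * Z.sgn n)%Z; ring. }
      { replace n with (2 * N * Z.sgn n)%Z at 1
          by (rewrite <- Hn; apply Z.abs_sgn).
        rewrite pow2_add, !mult_IZR; unfold B; simpl; ring. }
    * exists n, e; fold N; split; [lia|split; [assumption|reflexivity]].
  + apply Hsmall in Hs; lra.
Qed.

Lemma RN_spec (p : Z) (z : R) : (2 <= p)%Z -> is_RN p z (RN p z).
Proof. intros Hp; unfold RN; apply epsilon_spec, RN_exists, Hp. Qed.

Lemma last_bit_zero_opp (p : Z) (y : R) :
  last_bit_zero p y -> last_bit_zero p (- y).
Proof.
intros [m [e [Hm [[q Hq] ->]]]]; exists (- m)%Z, e; split; [lia|split].
- exists (- q)%Z; lia.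
- rewrite opp_IZR; ring.
Qed.

Lemma is_float_opp (p : Z) (y : R) : is_float p y -> is_float p (- y).
Proof.
intros [m [e [Hm ->]]]; exists (- m)%Z, e; split; [lia|].
rewrite opp_IZR; ring.
Qed.

Lemma float_between_pos (p : Z) (y1 y2 : R) : (2 <= p)%Z ->
  last_bit_zero p y1 -> last_bit_zero p y2 -> 0 < y1 -> y1 < y2 ->
  exists f, is_float p f /\ y1 < f < y2.
Proof.
intros Hp [m1 [e1 [Hm1 [[q1 Hq1] ->]]]] [m2 [e2 [Hm2 [[q2 Hq2] ->]]]] Hpos Hlt.
assert (HN2 : (2 ^ p = 2 * 2 ^ (p - 1))%Z).
{ replace p with (Z.succ (p - 1)) at 1 by lia.
  rewrite Z.pow_succ_r by lia; reflexivity. }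
pose proof (pow2_gt0 e1) as G1; pose proof (pow2_gt0 e2) as G2.
assert (P1 : (0 < m1)%Z) by (apply lt_IZR; nra).
assert (P2 : (0 < m2)%Z) by (apply lt_IZR; nra).
assert (He : (e1 <= e2)%Z).
{ destruct (Z_le_gt_dec e1 e2) as [|He]; [assumption|exfalso].
  assert (HB : 2 * powerRZ 2 e2 <= powerRZ 2 e1).
  { replace 2 with (powerRZ 2 1) at 1 by (simpl; ring).
    rewrite <- pow2_add; apply pow2_le; lia. }
  assert (IZR m2 <= 2 * IZR m1)
    by (rewrite <- mult_IZR; apply IZR_le; lia).
  assert (0 < IZR m1) by (apply IZR_lt; assumption).
  nra. }
assert (Hy2 : IZR m2 * powerRZ 2 e2 =
  IZR (2 * (q2 * 2 ^ (e2 - e1))) * powerRZ 2 e1).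
{ rewrite Z.mul_assoc, <- Hq2, mult_IZR, <- pow2_IZR by lia.
  rewrite Rmult_assoc, <- pow2_add; do 2 f_equal; lia. }
rewrite Hy2 in *.
apply Rmult_lt_reg_r, lt_IZR in Hlt; [|assumption].
exists (IZR (m1 + 1) * powerRZ 2 e1); split; [|split].
- exists (m1 + 1)%Z, e1; split; [lia|reflexivity].
- apply Rmult_lt_compat_r; [assumption|apply IZR_lt; lia].
- apply Rmult_lt_compat_r; [assumption|apply IZR_lt; lia].
Qed.

Lemma float_between (p : Z) (y1 y2 : R) : (2 <= p)%Z ->
  last_bit_zero p y1 -> last_bit_zero p y2 -> y1 < y2 ->
  exists f, is_float p f /\ y1 < f < y2.
Proof.
intros Hp H1 H2 Hlt.
assert (Hnz : forall y, last_bit_zero p y -> y <> 0).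
{ intros y [m [e [Hm [_ ->]]]].
  assert (0 < 2 ^ (p - 1))%Z by (apply Z.pow_pos_nonneg; lia).
  apply Rmult_integral_contrapositive_currified.
  - apply not_0_IZR; lia.
  - generalize (pow2_gt0 e); lra. }
pose proof (Hnz _ H1) as N1; pose proof (Hnz _ H2) as N2.
destruct (Rlt_le_dec 0 y1) as [P1|P1].
{ apply float_between_pos; assumption. }
destruct (Rlt_le_dec 0 y2) as [P2|P2].
{ exists 0; split; [|lra].
  exists 0%Z, 0%Z; split; [|simpl; ring].
  change (Z.abs 0) with 0%Z; apply Z.pow_pos_nonneg; lia. }
destruct (float_between_pos p (- y2) (- y1)) as [f [Hf1 Hf2]];
  try (apply last_bit_zero_opp; assumption); try assumption; try lra.
exists (- f); split; [apply is_float_opp; assumption|lra].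
Qed.

Lemma is_RN_unique (p : Z) (z y1 y2 : R) : (2 <= p)%Z ->
  is_RN p z y1 -> is_RN p z y2 -> y1 = y2.
Proof.
intros Hp.
assert (Hno : forall a b, is_RN p z a -> is_RN p z b -> ~ a < b).
{ intros a b [Fa [Ma Ta]] [Fb [Mb Tb]] Hlt.
  pose proof (Ma b Fb) as L1; pose proof (Mb a Fa) as L2.
  assert (Heq : Rabs (z - a) = Rabs (z - b)) by lra.
  destruct (float_between p a b Hp) as [f [Ff Hf]]; [| |assumption|].
  - apply (Ta b); [assumption|lra|auto].
  - apply (Tb a); [assumption|lra|auto].
  - pose proof (Ma f Ff) as L3.
    revert Heq L3; unfold Rabs; repeat destruct Rcase_abs; lra. }
intros H1 H2.
destruct (Rtotal_order y1 y2) as [H|[H|H]]; [exfalso|assumption|exfalso].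
- exact (Hno y1 y2 H1 H2 H).
- exact (Hno y2 y1 H2 H1 H).
Qed.

(* Main.v *)
(* A pair (h, l) with |l| <= 2^-p |h| stands for the real h + l.  Both Fast2Sum
   calls and the Fast2Mult call of DblMult are error-free there, so the only
   errors are the roundings giving t, s and y' and the neglected product al * bl:
   to first order 1 + 2 + 2 + 1 = 6 times 2^-2p, hence a relative error below
   eta = 7 * 2^-2p.  LogPower(x, n) accumulates at most n factors between 1 - eta
   and 1 + eta, and n * eta <= (7 / 8) * 2^-54 when n <= 2^49 and p = 53.
   Finally, distinct floats f, y satisfy |f - y| >= 2^-p |f|, so rounding to
   nearest an approximation of z of relative error below 2^-(p+1) is faithful. *)

Require Import Defs.
From Stdlib Require Import Reals ZArith Lra Lia.
Open Scope R_scope.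

Definition eta (p : Z) : R := 7 * (powerRZ 2 (- p) * powerRZ 2 (- p)).

Definition double_word (p : Z) (h l : R) : Prop :=
  is_float p h /\ is_float p l /\ Rabs l <= powerRZ 2 (- p) * Rabs h.

(* [c] counts the factors in [1 - eta, 1 + eta] separating [X] from [Y]. *)
Definition approx (p : Z) (c : nat) (X Y : R) : Prop :=
  exists t, X = Y * t /\ (1 - eta p) ^ c <= t <= (1 + eta p) ^ c.

(** * Floats as integer multiples of powers of two *)

Lemma pow2_lt_inv (a b : Z) : powerRZ 2 a < powerRZ 2 b -> (a < b)%Z.
Proof.
intros H; destruct (Z_lt_le_dec a b) as [|Hba]; [assumption|].
apply pow2_le in Hba; lra.
Qed.

Lemma pow2_double (e : Z) : powerRZ 2 (e + 1) = 2 * powerRZ 2 e.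
Proof. rewrite pow2_add; simpl; ring. Qed.

Lemma pow2_opp_mul (p : Z) : powerRZ 2 (- p) * powerRZ 2 p = 1.
Proof. rewrite <- pow2_add, Z.add_opp_diag_l; reflexivity. Qed.

Lemma Rabs_mul_pow2 (m e : Z) :
  Rabs (IZR m * powerRZ 2 e) = IZR (Z.abs m) * powerRZ 2 e.
Proof.
rewrite Rabs_mult, abs_IZR, (Rabs_pos_eq (powerRZ 2 e)); [reflexivity|].
apply Rlt_le, pow2_gt0.
Qed.

Lemma is_float_0 (p : Z) : (0 <= p)%Z -> is_float p 0.
Proof.
intros Hp; exists 0%Z, 0%Z; split; [|simpl; ring].
apply Z.pow_pos_nonneg; lia.
Qed.

Lemma is_float_pow2 (p e : Z) : (1 <= p)%Z -> is_float p (powerRZ 2 e).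
Proof.
intros Hp; exists 1%Z, e; split; [|ring].
apply (Z.pow_gt_1 2); lia.
Qed.

Lemma is_float_mul_pow2 (p m e : Z) : (0 <= p)%Z ->
  Rabs (IZR m * powerRZ 2 e) < powerRZ 2 (p + e) -> is_float p (IZR m * powerRZ 2 e).
Proof.
intros Hp H; exists m, e; split; [|reflexivity].
rewrite Rabs_mul_pow2, pow2_add, (pow2_IZR p) in H by assumption.
apply lt_IZR, Rmult_lt_reg_r with (2 := H), pow2_gt0.
Qed.

Lemma float_abs_lt (p m e : Z) : (0 <= p)%Z -> (Z.abs m < 2 ^ p)%Z ->
  Rabs (IZR m * powerRZ 2 e) < powerRZ 2 (p + e).
Proof.
intros Hp H; rewrite Rabs_mul_pow2, pow2_add, (pow2_IZR p) by assumption.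
apply Rmult_lt_compat_r; [apply pow2_gt0|apply IZR_lt, H].
Qed.

Lemma mul_pow2_rescale (m e e' : Z) : (e <= e')%Z ->
  exists m', IZR m * powerRZ 2 e' = IZR m' * powerRZ 2 e.
Proof.
intros H; exists (m * 2 ^ (e' - e))%Z.
rewrite mult_IZR, <- pow2_IZR, Rmult_assoc, <- pow2_add by lia.
do 2 f_equal; lia.
Qed.

(** A significand below [2 ^ p] with an exponent under [e] would give a magnitude below [2^(p+e-1)].
    This puts large enough floats on a common grid. *)
Lemma float_multiple (p e : Z) (f : R) : (0 <= p)%Z -> is_float p f ->
  powerRZ 2 (p + e - 1) <= Rabs f -> exists m, f = IZR m * powerRZ 2 e.
Proof.
intros Hp [m [e' [Hm ->]]] H.
apply mul_pow2_rescale.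
pose proof (float_abs_lt p m e' Hp Hm) as H'.
assert (p + e - 1 < p + e')%Z by (apply pow2_lt_inv; lra); lia.
Qed.

Lemma float_normalize (p : Z) (f : R) : (1 <= p)%Z -> is_float p f -> f <> 0 ->
  exists m e, (2 ^ (p - 1) <= Z.abs m < 2 ^ p)%Z /\ f = IZR m * powerRZ 2 e.
Proof.
intros Hp Hf Hf0.
destruct (binade_exists f Hf0) as [k [Hk1 Hk2]].
destruct (float_multiple p (k - p + 1) f) as [m ->]; [lia|assumption| |].
{ replace (p + (k - p + 1) - 1)%Z with k by lia; assumption. }
exists m, (k - p + 1)%Z; split; [|reflexivity].
rewrite Rabs_mul_pow2 in Hk1, Hk2.
set (e := (k - p + 1)%Z) in *.
replace (k + 1)%Z with (p + e)%Z in Hk2 by lia.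
replace k with (p - 1 + e)%Z in Hk1 by lia.
rewrite (pow2_add p e), (pow2_IZR p) in Hk2 by lia.
rewrite (pow2_add (p - 1) e), (pow2_IZR (p - 1)) in Hk1 by lia.
split.
- apply le_IZR, Rmult_le_reg_r with (2 := Hk1), pow2_gt0.
- apply lt_IZR, Rmult_lt_reg_r with (2 := Hk2), pow2_gt0.
Qed.

(* The extreme case is f = 2^k with y its neighbour of smaller magnitude. *)
Lemma float_dist (p : Z) (f y : R) : (1 <= p)%Z -> is_float p f -> is_float p y ->
  f <> y -> powerRZ 2 (- p) * Rabs f <= Rabs (f - y).
Proof.
intros Hp Hf Hy Hne.
destruct (Req_dec f 0) as [->|Hf0].
{ rewrite Rabs_R0, Rmult_0_r; apply Rabs_pos. }
destruct (float_normalize p f Hp Hf Hf0) as [m [e [Hm ->]]].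
destruct Hy as [m' [e' [Hm' ->]]].
set (N := (2 ^ (p - 1))%Z) in *.
assert (HN : (2 ^ p = 2 * N)%Z).
{ unfold N; rewrite <- Z.pow_succ_r by lia; f_equal; lia. }
assert (HN0 : (1 <= N)%Z) by (apply (Z.pow_le_mono_r 2 0); lia).
assert (Heps : powerRZ 2 (- p) * (2 * IZR N) = 1).
{ rewrite <- mult_IZR, <- HN, <- pow2_IZR by lia; apply pow2_opp_mul. }
pose proof (pow2_gt0 (- p)) as Heps0.
destruct (Z_le_gt_dec e e') as [He|He].
(* Here [y] lies on the grid of [f], so the distance is at least one unit [2^e], while
   [|f| <= 2^p * 2^e]. *)
- destruct (mul_pow2_rescale m' e e' He) as [q Hq]; rewrite Hq in *.
  replace (IZR m * powerRZ 2 e - IZR q * powerRZ 2 e)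
    with (IZR (m - q) * powerRZ 2 e) by (rewrite minus_IZR; ring).
  assert (m <> q) by congruence.
  rewrite !Rabs_mul_pow2.
  assert (1 <= IZR (Z.abs (m - q))) by (apply IZR_le; lia).
  assert (IZR (Z.abs m) <= 2 * IZR N) by (rewrite <- mult_IZR; apply IZR_le; lia).
  rewrite <- Rmult_assoc; apply Rmult_le_compat_r; [apply Rlt_le, pow2_gt0|nra].
- assert (HB : powerRZ 2 e = 2 * powerRZ 2 (e - 1)).
  { rewrite <- pow2_double; f_equal; lia. }
  assert (Hy : Rabs (IZR m' * powerRZ 2 e') <= (2 * IZR N - 1) * powerRZ 2 (e - 1)).
  { rewrite Rabs_mul_pow2; apply Rmult_le_compat.
    - apply IZR_le; lia.
    - apply Rlt_le, pow2_gt0.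
    - rewrite <- mult_IZR, <- minus_IZR; apply IZR_le; lia.
    - apply pow2_le; lia. }
  pose proof (Rabs_triang_inv (IZR m * powerRZ 2 e) (IZR m' * powerRZ 2 e')) as Ht.
  rewrite (Rabs_mul_pow2 m e), HB in *.
  pose proof (pow2_gt0 (e - 1)) as HB0.
  assert (IZR N <= IZR (Z.abs m)) by (apply IZR_le; lia).
  assert (1 <= IZR N) by (apply IZR_le; lia).
  (* At [|m| = N] both sides equal 1; beyond it the right side grows at least as fast, since
     [2^-p <= 1]. *)
  assert (Hj : powerRZ 2 (- p) * (2 * IZR (Z.abs m)) <=
    2 * IZR (Z.abs m) - (2 * IZR N - 1)).
  { clear - H H0 Heps Heps0.
    generalize dependent (powerRZ 2 (- p)); intros eps Heps0 Heps.
    assert (eps <= 1) by nra; nra. }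
  apply (Rmult_le_compat_r (powerRZ 2 (e - 1))) in Hj; lra.
Qed.

(** * Rounding to nearest, its error, and error-free sums and products *)

Section Rounding.

Variable p : Z.
Hypothesis Hp : (2 <= p)%Z.

Lemma RN_float (z : R) : is_float p (RN p z).
Proof. apply RN_spec, Hp. Qed.

Lemma RN_nearest (z f : R) : is_float p f -> Rabs (z - RN p z) <= Rabs (z - f).
Proof. apply RN_spec, Hp. Qed.

Lemma RN_id (z : R) : is_float p z -> RN p z = z.
Proof.
intros Hz; pose proof (RN_nearest z z Hz) as H.
rewrite Rminus_diag, Rabs_R0 in H.
destruct (Req_dec (z - RN p z) 0) as [H0|H0]; [lra|].
apply Rabs_pos_lt in H0; lra.
Qed.

Lemma RN_ge_pow2 (z : R) (k : Z) : powerRZ 2 k <= Rabs z ->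
  powerRZ 2 k <= Rabs (RN p z).
Proof.
intros H.
assert (F : is_float p (powerRZ 2 k)) by (apply is_float_pow2; lia).
pose proof (RN_nearest z _ F) as H1.
pose proof (RN_nearest z _ (is_float_opp _ _ F)) as H2.
pose proof (pow2_gt0 k).
revert H H1 H2; unfold Rabs; repeat destruct Rcase_abs; lra.
Qed.

Lemma RN_half_ulp (z : R) (k : Z) : powerRZ 2 k <= Rabs z < powerRZ 2 (k + 1) ->
  Rabs (z - RN p z) <= powerRZ 2 (- p) * powerRZ 2 k.
Proof.
intros [Hk1 Hk2].
set (e := (k - p + 1)%Z).
pose proof (pow2_gt0 e) as HB.
assert (Hke : powerRZ 2 (- p) * powerRZ 2 k = / 2 * powerRZ 2 e).
{ rewrite <- pow2_add; unfold e.
  replace (k - p + 1)%Z with ((- p + k) + 1)%Z by lia.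
  rewrite pow2_double; field. }
destruct (nearest_even_int (z / powerRZ 2 e)) as [n [Hn _]].
assert (Hdist : forall j, Rabs (z - IZR j * powerRZ 2 e) =
  Rabs (z / powerRZ 2 e - IZR j) * powerRZ 2 e).
{ intros j; rewrite <- (Rabs_pos_eq (powerRZ 2 e)) at 3 by lra.
  rewrite <- Rabs_mult; f_equal; field; lra. }
assert (Hhalf : Rabs (z / powerRZ 2 e - IZR n) <= / 2).
{ set (t := z / powerRZ 2 e) in *.
  destruct (base_Int_part t) as [H1 H2].
  pose proof (Hn (Int_part t)) as A1; pose proof (Hn (Int_part t + 1)%Z) as A2.
  rewrite plus_IZR in A2.
  revert A1 A2; unfold Rabs; repeat destruct Rcase_abs; lra. }
assert (Hnp : Rabs (IZR n * powerRZ 2 e) <= powerRZ 2 (p + e)).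
{ assert (Ht : Rabs (z / powerRZ 2 e) <= IZR (2 ^ p)).
  { unfold Rdiv; rewrite Rabs_mult, (Rabs_pos_eq (/ powerRZ 2 e))
      by (apply Rlt_le, Rinv_0_lt_compat, HB).
    apply Rmult_le_reg_r with (powerRZ 2 e); [assumption|].
    rewrite <- pow2_IZR, <- pow2_add by lia.
    replace (p + e)%Z with (k + 1)%Z by (unfold e; lia).
    rewrite Rmult_assoc, Rinv_l by lra; lra. }
  rewrite Rabs_mul_pow2, (pow2_add p e), (pow2_IZR p) by lia.
  apply Rmult_le_compat_r; [lra|].
  rewrite abs_IZR.
  assert (IZR (Z.abs n) < IZR (2 ^ p + 1)).
  { rewrite plus_IZR, abs_IZR.
    revert Hhalf Ht; unfold Rabs; repeat destruct Rcase_abs; lra. }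
  rewrite <- abs_IZR; apply lt_IZR in H; apply IZR_le; lia. }
assert (F : is_float p (IZR n * powerRZ 2 e)).
(* The rounded significand may reach [2 ^ p] and no longer fit in [p] bits; the candidate is then a
   power of two up to sign, still a float. *)
{ destruct Hnp as [Hlt|Heq]; [apply is_float_mul_pow2; [lia|assumption]|].
  revert Heq; unfold Rabs; destruct Rcase_abs; intros Heq.
  - replace (IZR n * powerRZ 2 e) with (- powerRZ 2 (p + e)) by lra.
    apply is_float_opp, is_float_pow2; lia.
  - rewrite Heq; apply is_float_pow2; lia. }
apply Rle_trans with (1 := RN_nearest z _ F).
rewrite Hdist, Hke; apply Rmult_le_compat_r; lra.
Qed.

(** In the binade of [z], [2^k] is a lower bound for both [|z|] and [|RN p z|]. The first form
    drives the error analysis; the second yields the [double_word] condition on the output of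
    Fast2Sum. *)
Lemma RN_error (z : R) : Rabs (z - RN p z) <= powerRZ 2 (- p) * Rabs z /\
  Rabs (z - RN p z) <= powerRZ 2 (- p) * Rabs (RN p z).
Proof.
pose proof (pow2_gt0 (- p)) as Heps.
destruct (Req_dec z 0) as [->|Hz].
{ rewrite RN_id by (apply is_float_0; lia).
  rewrite Rminus_0_r, Rabs_R0; lra. }
destruct (binade_exists z Hz) as [k Hk].
pose proof (RN_half_ulp z k Hk) as H.
pose proof (RN_ge_pow2 z k (proj1 Hk)).
split; eapply Rle_trans; try exact H; apply Rmult_le_compat_l; lra.
Qed.

(** Multiples of [2^e] below [2^(p+e)] are floats already; above, rounding stays at or above
    [2^(p+e)], where every float is a multiple of [2^e]. *)
Lemma RN_multiple (m e : Z) :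
  exists m', RN p (IZR m * powerRZ 2 e) = IZR m' * powerRZ 2 e.
Proof.
destruct (Rlt_le_dec (Rabs (IZR m * powerRZ 2 e)) (powerRZ 2 (p + e))) as [H|H].
- exists m; apply RN_id, is_float_mul_pow2; [lia|assumption].
- apply (float_multiple p); [lia|apply RN_float|].
  apply Rle_trans with (powerRZ 2 (p + e)); [apply pow2_le; lia|].
  apply RN_ge_pow2, H.
Qed.

(** The common reason why rounding errors are representable: the error stays on the grid of [z], so
    only its size matters. *)
Lemma rounding_error_float (m e : Z) (z : R) : z = IZR m * powerRZ 2 e ->
  Rabs (z - RN p z) < powerRZ 2 (p + e) -> is_float p (z - RN p z).
Proof.
intros -> H.
destruct (RN_multiple m e) as [m' Hm']; rewrite Hm' in *.
revert H; replace (IZR m * powerRZ 2 e - IZR m' * powerRZ 2 e)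
  with (IZR (m - m') * powerRZ 2 e) by (rewrite minus_IZR; ring).
apply is_float_mul_pow2; lia.
Qed.

Lemma mul_error_float (a b : R) : is_float p a -> is_float p b ->
  is_float p (a * b - RN p (a * b)).
Proof.
intros [ma [ea [Ha ->]]] [mb [eb [Hb ->]]].
pose proof (float_abs_lt p ma ea ltac:(lia) Ha) as La.
pose proof (float_abs_lt p mb eb ltac:(lia) Hb) as Lb.
apply rounding_error_float with (ma * mb)%Z (ea + eb)%Z.
{ rewrite mult_IZR, pow2_add; ring. }
apply Rle_lt_trans with (1 := proj1 (RN_error _)).
rewrite Rabs_mult.
apply Rlt_le_trans with (powerRZ 2 (- p) * (powerRZ 2 (p + ea) * powerRZ 2 (p + eb))).
- apply Rmult_lt_compat_l; [apply pow2_gt0|].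
  apply Rmult_le_0_lt_compat; try apply Rabs_pos; assumption.
- rewrite <- !pow2_add; apply pow2_le; lia.
Qed.

Lemma add_error_float (a b : R) : is_float p a -> is_float p b ->
  is_float p (a + b - RN p (a + b)).
Proof.
(* Both summands are candidates for the rounding, so the error is at most
   min(|a|, |b|), hence below 2^(p + e) for the smaller exponent e. *)
assert (Hle : forall a b ea, is_float p a -> is_float p b ->
  (exists ma, (Z.abs ma < 2 ^ p)%Z /\ a = IZR ma * powerRZ 2 ea) ->
  (exists mb, b = IZR mb * powerRZ 2 ea) -> is_float p (a + b - RN p (a + b))).
{ intros a' b' e Fa Fb [ma [Ha Ea]] [mb Eb].
  apply rounding_error_float with (ma + mb)%Z e.
  { rewrite Ea, Eb, plus_IZR; ring. }
  apply Rle_lt_trans with (Rabs a').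
  - eapply Rle_trans; [apply (RN_nearest _ b'), Fb|].
    right; f_equal; ring.
  - rewrite Ea; apply float_abs_lt; [lia|assumption]. }
intros Fa Fb; pose proof Fa as [ma [ea [Ha Ea]]]; pose proof Fb as [mb [eb [Hb Eb]]].
destruct (Z_le_gt_dec ea eb) as [He|He].
- apply Hle with ea; eauto.
  rewrite Eb; apply mul_pow2_rescale, He.
- rewrite (Rplus_comm a b); apply Hle with eb; eauto.
  rewrite Ea; apply mul_pow2_rescale; lia.
Qed.

(** Makes the inner subtraction of Fast2Sum exact. With [2^k <= |a| < 2^(k+1)], the sum has
    magnitude at least [2^(k-1)], so it and [a] are multiples of [2^(k-p)]; since [a] is itself a
    candidate, the difference is at most [2|b| <= |a|/2 < 2^k]. *)
Lemma add_sub_float (a b : R) : is_float p a -> is_float p b ->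
  4 * Rabs b <= Rabs a -> is_float p (RN p (a + b) - a).
Proof.
intros Fa Fb Hab.
destruct (Req_dec a 0) as [->|Ha].
{ rewrite Rplus_0_l, Rminus_0_r; apply RN_float. }
destruct (binade_exists a Ha) as [k [Hk1 Hk2]].
assert (Hk3 : powerRZ 2 (k + 1) = 4 * powerRZ 2 (k - 1)).
{ replace (k + 1)%Z with (k - 1 + 1 + 1)%Z by lia; rewrite !pow2_double; ring. }
assert (Hk4 : powerRZ 2 k = 2 * powerRZ 2 (k - 1)).
{ rewrite <- pow2_double; f_equal; lia. }
assert (Hs : powerRZ 2 (k - 1) <= Rabs (RN p (a + b))).
{ apply RN_ge_pow2.
  pose proof (Rabs_triang_inv a (- b)) as Ht; rewrite Rabs_Ropp in Ht.
  replace (a - - b) with (a + b) in Ht by ring; lra. }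
destruct (float_multiple p (k - p) (RN p (a + b))) as [ms Hms]; [lia|apply RN_float| |].
{ replace (p + (k - p) - 1)%Z with (k - 1)%Z by lia; assumption. }
destruct (float_multiple p (k - p) a) as [ma Hma]; [lia|assumption| |].
{ apply Rle_trans with (2 := Hk1), pow2_le; lia. }
assert (Hd : Rabs (RN p (a + b) - a) < powerRZ 2 (p + (k - p))).
{ replace (p + (k - p))%Z with k by lia.
  pose proof (RN_nearest (a + b) a Fa) as H1.
  replace (a + b - a) with b in H1 by ring.
  revert H1 Hab Hk2; unfold Rabs; repeat destruct Rcase_abs; lra. }
revert Hd; rewrite Hms.
rewrite Hma; replace (IZR ms * powerRZ 2 (k - p) - IZR ma * powerRZ 2 (k - p))
  with (IZR (ms - ma) * powerRZ 2 (k - p)) by (rewrite minus_IZR; ring).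
apply is_float_mul_pow2; lia.
Qed.

Lemma Fast2Mult_exact (a b : R) : is_float p a -> is_float p b ->
  Fast2Mult p a b = (RN p (a * b), a * b - RN p (a * b)).
Proof.
intros Fa Fb; unfold Fast2Mult; f_equal.
apply RN_id, mul_error_float; assumption.
Qed.

Lemma Fast2Sum_exact (a b : R) : is_float p a -> is_float p b ->
  4 * Rabs b <= Rabs a -> Fast2Sum p a b = (RN p (a + b), a + b - RN p (a + b)).
Proof.
intros Fa Fb Hab; unfold Fast2Sum; f_equal.
rewrite (RN_id (_ - a)) by (apply add_sub_float; assumption).
replace (b - (RN p (a + b) - a)) with (a + b - RN p (a + b)) by ring.
apply RN_id, add_error_float; assumption.
Qed.

Lemma faithful_RN (z d : R) : Rabs d < powerRZ 2 (- p - 1) ->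
  faithful p z (RN p (z * (1 + d))).
Proof.
intros Hd.
set (X := z * (1 + d)); set (y := RN p X).
assert (Heps : powerRZ 2 (- p) = 2 * powerRZ 2 (- p - 1)).
{ rewrite <- pow2_double; f_equal; lia. }
assert (Heps1 : powerRZ 2 (- p - 1) <= 1) by (apply (pow2_le _ 0); lia).
assert (Hzd : Rabs (X - z) = Rabs d * Rabs z).
{ rewrite <- Rabs_mult; f_equal; unfold X; ring. }
(* A float f strictly between y and z (or equal to z) is at least as far from X
   as y, so |X - z| >= |f - y| / 2 + |z - f| >= 2^-(p+1) |z|. *)
assert (Hno : forall f, is_float p f -> f <> y ->
  ~ Rabs (f - y) / 2 + Rabs (z - f) <= Rabs (X - z)).
{ intros f Ff Hfy H.
  pose proof (float_dist p f y ltac:(lia) Ff (RN_float _) Hfy) as H1.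
  assert (H2 : 0 < Rabs (f - y)) by (apply Rabs_pos_lt; lra).
  pose proof (Rabs_triang f (z - f)) as H3.
  replace (f + (z - f)) with z in H3 by ring.
  pose proof (Rabs_pos z); pose proof (Rabs_pos (z - f)); pose proof (Rabs_pos d).
  rewrite Hzd in H; rewrite Heps in H1.
  destruct (Req_dec z 0) as [->|Hz].
  { rewrite Rabs_R0 in H; lra. }
  apply Rabs_pos_lt in Hz.
  assert (Rabs d * Rabs z < powerRZ 2 (- p - 1) * Rabs z) by nra.
  assert (powerRZ 2 (- p - 1) * Rabs z <=
    powerRZ 2 (- p - 1) * Rabs f + powerRZ 2 (- p - 1) * Rabs (z - f)) by
    (generalize (pow2_gt0 (- p - 1)); nra).
  assert (powerRZ 2 (- p - 1) * Rabs (z - f) <= Rabs (z - f)) by nra.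
  lra. }
(* A float [f] contradicting extremality lies between [y] and [z]. As [y] is nearest to [X], [X] is
   on the [y] side of the midpoint of [f] and [y], which is the inequality refuted by [Hno]. *)
destruct (Rle_lt_dec y z) as [Hyz|Hyz]; [left|right];
  (split; [apply RN_float|split; [lra|]]); intros f Ff Hf;
  apply Rnot_lt_le; intros Hlt; apply (Hno f Ff); try lra;
  pose proof (RN_nearest X f Ff) as H; fold y in H;
  revert H; unfold Rabs; repeat destruct Rcase_abs; lra.
Qed.

End Rounding.

(** * Error of one double-word product *)

Lemma DblMult_spec (p : Z) (ah al bh bl x y : R) : (7 <= p)%Z ->
  double_word p ah al -> double_word p bh bl -> DblMult p ah al bh bl = (x, y) ->
  double_word p x y /\
  Rabs (x + y - (ah + al) * (bh + bl)) <= eta p * Rabs ((ah + al) * (bh + bl)).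
Proof.
intros Hp [Fah [Fal Ha]] [Fbh [Fbl Hb]].
assert (Hp2 : (2 <= p)%Z) by lia.
set (eps := powerRZ 2 (- p)) in *.
assert (Heps0 : 0 < eps) by apply pow2_gt0.
assert (Heps1 : 128 * eps <= 1).
{ replace 128 with (powerRZ 2 7) by (simpl; ring).
  unfold eps; rewrite <- pow2_add; apply (pow2_le _ 0); lia. }
(* Successive orders of magnitude, each at most 1/128 of the previous one; every later bound is
   linear in them. *)
set (P := Rabs ah * Rabs bh); set (Q := eps * P); set (W := eps * Q); set (V := eps * W).
assert (HP : 0 <= P) by (apply Rmult_le_pos; apply Rabs_pos).
assert (HQ : 0 <= Q) by (unfold Q; nra).
assert (HW : 0 <= W) by (unfold W; nra).
assert (HV : 0 <= V) by (unfold V; nra).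
assert (HQP : 128 * Q <= P) by (unfold Q; nra).
assert (HWQ : 128 * W <= Q) by (unfold W; nra).
assert (HVW : 128 * V <= W) by (unfold V; nra).
assert (Hhh : Rabs (ah * bh) = P) by apply Rabs_mult.
assert (Hlh : Rabs (al * bh) <= Q).
{ rewrite Rabs_mult; unfold Q, P; generalize (Rabs_pos bh); nra. }
assert (Hhl : Rabs (ah * bl) <= Q).
{ rewrite Rabs_mult; unfold Q, P; generalize (Rabs_pos ah); nra. }
assert (Hll : Rabs (al * bl) <= W).
{ rewrite Rabs_mult; unfold W, Q, P.
  replace (eps * (eps * (Rabs ah * Rabs bh)))
    with ((eps * Rabs ah) * (eps * Rabs bh)) by ring.
  apply Rmult_le_compat; try apply Rabs_pos; assumption. }
assert (Herr : forall z c, Rabs z <= c -> Rabs (z - RN p z) <= eps * c).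
{ intros z c Hz; apply Rle_trans with (1 := proj1 (RN_error p Hp2 z)).
  apply Rmult_le_compat_l; lra. }
unfold DblMult.
rewrite Fast2Mult_exact by assumption.
set (t := RN p (al * bh)); set (s := RN p (ah * bl + t)).
set (x' := RN p (ah * bh)); set (u := ah * bh - x').
assert (Et : Rabs (al * bh - t) <= W) by (apply Herr, Hlh).
assert (Hz1 : Rabs (ah * bl + t) <= 2 * Q + W).
{ revert Et Hlh Hhl; clear; unfold Rabs; repeat destruct Rcase_abs; lra. }
assert (Es : Rabs (ah * bl + t - s) <= 2 * W + V).
{ apply Herr in Hz1; fold s in Hz1; unfold V, W in *; lra. }
assert (Eu : Rabs u <= Q) by (apply Herr; lra).
assert (Hs : Rabs s <= 2 * Q + 4 * W).
{ revert Es Hz1 HVW HW; clear; unfold Rabs; repeat destruct Rcase_abs; lra. }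
assert (Hx'1 : P - Q <= Rabs x').
{ pose proof (Rabs_triang_inv (ah * bh) u) as H.
  replace (ah * bh - u) with x' in H by (unfold u; ring); lra. }
assert (Hx'2 : Rabs x' <= P + Q).
{ pose proof (Rabs_triang (ah * bh) (- u)) as H; rewrite Rabs_Ropp in H.
  replace (ah * bh + - u) with x' in H by (unfold u; ring); lra. }
rewrite Fast2Sum_exact; try (apply RN_float, Hp2); [|assumption|lra].
set (x'' := RN p (x' + s)); set (v := x' + s - x'').
assert (Hz2 : Rabs (x' + s) <= P + 4 * Q).
{ pose proof (Rabs_triang x' s); lra. }
assert (Ev : Rabs v <= Q + 4 * W).
{ apply Herr in Hz2; fold x'' v in Hz2; unfold W, Q in *; lra. }
set (y' := RN p (u + v)).
assert (Hz3 : Rabs (u + v) <= 2 * Q + 4 * W).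
{ pose proof (Rabs_triang u v); lra. }
assert (Ey : Rabs (u + v - y') <= 2 * W + 4 * V).
{ apply Herr in Hz3; fold y' in Hz3; unfold V, W in *; lra. }
assert (Hy' : Rabs y' <= 3 * Q).
{ revert Ey Hz3 HVW HWQ HW HV; clear; unfold Rabs; repeat destruct Rcase_abs; lra. }
(* A crude bound suffices: the second Fast2Sum needs only [4 * (3 * Q) <= P - 8 * Q]. *)
assert (Hx'' : P - 8 * Q <= Rabs x'').
{ assert (Hv : Rabs v <= 2 * Q) by lra.
  assert (Hs' : Rabs s <= 3 * Q) by lra.
  assert (Hxv : x'' = x' + s - v) by (unfold v; ring).
  clearbody x' s v x''; subst x''; clear - Hv Hs' Hx'1.
  revert Hv Hs' Hx'1; unfold Rabs; repeat destruct Rcase_abs; lra. }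
rewrite Fast2Sum_exact; try (apply RN_float, Hp2); [|assumption|lra].
intros Hxy; injection Hxy as <- <-.
assert (F : is_float p (x'' + y' - RN p (x'' + y'))).
{ apply add_error_float; try assumption; apply RN_float, Hp2. }
split.
{ split; [apply RN_float, Hp2|split; [exact F|]].
  apply RN_error, Hp2. }
assert (HE : P - 2 * Q - W <= Rabs ((ah + al) * (bh + bl))).
{ replace ((ah + al) * (bh + bl)) with (ah * bh + (al * bh + ah * bl + al * bl)) by ring.
  pose proof (Rabs_triang_inv (ah * bh) (- (al * bh + ah * bl + al * bl))) as H.
  rewrite Rabs_Ropp in H.
  replace (ah * bh - - (al * bh + ah * bl + al * bl))
    with (ah * bh + (al * bh + ah * bl + al * bl)) in H by ring.
  pose proof (Rabs_triang (al * bh + ah * bl) (al * bl)).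
  pose proof (Rabs_triang (al * bh) (ah * bl)); lra. }
assert (Heta : 7 * (W - 3 * V) <= eta p * Rabs ((ah + al) * (bh + bl))).
{ apply Rle_trans with (eta p * (P - 2 * Q - W)).
  - unfold eta; fold eps.
    replace (7 * (eps * eps) * (P - 2 * Q - W)) with (7 * (W - 2 * V - eps * V))
      by (unfold V, W, Q; ring).
    nra.
  - apply Rmult_le_compat_l; [unfold eta; fold eps; nra|assumption]. }
apply Rle_trans with (2 := Heta).
(* The exact transformations cancel, leaving the roundings of [t], [s], [y'] and the neglected
   product. Their bounds sum to [W + (2 * W + V) + (2 * W + 4 * V) + W = 6 * W + 5 * V], which is
   below [7 * (W - 3 * V)] because [128 * V <= W]. *)
replace (RN p (x'' + y') + (x'' + y' - RN p (x'' + y')) - (ah + al) * (bh + bl))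
  with (- ((al * bh - t) + (ah * bl + t - s) + (u + v - y') + al * bl))
  by (unfold v, u; ring).
rewrite Rabs_Ropp.
eapply Rle_trans; [apply Rabs_triang|].
eapply Rle_trans; [apply Rplus_le_compat_r, Rabs_triang|].
pose proof (Rabs_triang (al * bh - t) (ah * bl + t - s)); lra.
Qed.

(** * Accumulation of error factors along the loop *)

Lemma eta_bounds (p : Z) : (2 <= p)%Z -> 0 < eta p < 1.
Proof.
intros Hp; unfold eta.
pose proof (pow2_gt0 (- p)).
assert (4 * powerRZ 2 (- p) <= 1).
{ replace 4 with (powerRZ 2 2) by (simpl; ring).
  rewrite <- pow2_add; apply (pow2_le _ 0); lia. }
nra.
Qed.

Lemma approx_refl (p : Z) (X : R) : approx p 0 X X.
Proof. exists 1; simpl; lra. Qed.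

Lemma approx_mul (p : Z) (a b : nat) (X X' Y Y' : R) : (2 <= p)%Z ->
  approx p a X X' -> approx p b Y Y' -> approx p (a + b) (X * Y) (X' * Y').
Proof.
intros Hp [s [-> [Hs1 Hs2]]] [t [-> [Ht1 Ht2]]].
pose proof (eta_bounds p Hp).
assert (0 <= (1 - eta p) ^ a) by (apply pow_le; lra).
assert (0 <= (1 - eta p) ^ b) by (apply pow_le; lra).
exists (s * t); split; [ring|].
rewrite !pow_add; split; apply Rmult_le_compat; lra.
Qed.

Lemma DblMult_approx (p : Z) (a b : nat) (ah al bh bl x y A B : R) : (7 <= p)%Z ->
  double_word p ah al -> double_word p bh bl -> DblMult p ah al bh bl = (x, y) ->
  approx p a (ah + al) A -> approx p b (bh + bl) B ->
  double_word p x y /\ approx p (a + b + 1) (x + y) (A * B).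
Proof.
intros Hp Da Db Hxy HA HB.
destruct (DblMult_spec p ah al bh bl x y Hp Da Db Hxy) as [Hd He].
split; [exact Hd|].
rewrite <- (Rmult_1_r (x + y)), <- (Rmult_1_r (A * B)).
set (E := (ah + al) * (bh + bl)) in *.
assert (HE : approx p (a + b) E (A * B)) by (apply approx_mul; auto; lia).
destruct HE as [s [Es Hs]].
destruct (eta_bounds p ltac:(lia)) as [Heta0 Heta1].
(* When [E = 0] the relative error bound forces [x + y = 0], so the default factor 1 works. *)
set (t := if Req_dec_T E 0 then 1 else (x + y) / E).
assert (Ht : x + y = E * t /\ 1 - eta p <= t <= 1 + eta p).
{ unfold t; destruct (Req_dec_T E 0) as [HE0|HE0].
  - rewrite HE0, Rabs_R0, Rmult_0_r, Rminus_0_r in He.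
    split; [|lra].
    destruct (Req_dec (x + y) 0) as [|H0]; [lra|].
    apply Rabs_pos_lt in H0; lra.
  - split; [field; assumption|].
    assert (Hd' : Rabs ((x + y) / E - 1) <= eta p).
    { replace ((x + y) / E - 1) with ((x + y - E) / E) by (field; assumption).
      unfold Rdiv; rewrite Rabs_mult, Rabs_inv.
      apply Rabs_pos_lt in HE0.
      apply Rmult_le_reg_r with (Rabs E); [assumption|].
      rewrite Rmult_assoc, Rinv_l by lra; lra. }
    revert Hd'; unfold Rabs; destruct Rcase_abs; lra. }
destruct Ht as [Ext Ht].
rewrite !Rmult_1_r, Ext, <- (Rmult_1_r (A * B)).
apply approx_mul; [lia|exists s; auto|].
exists t; rewrite !pow_1, Rmult_1_l; auto.
Qed.

(** The count [a + i * (b + 1)] is a loop invariant: squaring turns [b + 1] into [2 * (b + 1)] while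
    [i] is halved, and for odd [i] the lost unit is compensated by the product into [(h, l)], which
    adds [b + 1] to [a]. Starting from [a = b = 0] it equals [n]. *)
Lemma LogPower_loop_approx (p : Z) (i : positive) : (7 <= p)%Z ->
  forall (a b : nat) (h l u v x y H U : R),
  double_word p h l -> double_word p u v ->
  approx p a (h + l) H -> approx p b (u + v) U ->
  LogPower_loop p i h l u v = (x, y) ->
  approx p (a + Pos.to_nat i * (b + 1)) (x + y) (H * U ^ Pos.to_nat i).
Proof.
intros Hp; induction i as [j IH|j IH|]; intros a b h l u v x y H U Dh Du Hh Hu;
  cbn [LogPower_loop].
- destruct (DblMult p h l u v) as [h' l'] eqn:Eh.
  destruct (DblMult p u v u v) as [u' v'] eqn:Eu; intros E.
  destruct (DblMult_approx p a b _ _ _ _ _ _ _ _ Hp Dh Du Eh Hh Hu) as [Dh' Hh'].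
  destruct (DblMult_approx p b b _ _ _ _ _ _ _ _ Hp Du Du Eu Hu Hu) as [Du' Hu'].
  pose proof (IH _ _ _ _ _ _ _ _ _ _ Dh' Du' Hh' Hu' E) as R.
  replace (H * U ^ Pos.to_nat j~1) with (H * U * (U * U) ^ Pos.to_nat j).
  + replace (a + Pos.to_nat j~1 * (b + 1))%nat
      with (a + b + 1 + Pos.to_nat j * (b + b + 1 + 1))%nat by lia.
    exact R.
  + rewrite Pos2Nat.inj_xI, <- tech_pow_Rmult, pow_mult.
    replace (U ^ 2) with (U * U) by ring; ring.
- destruct (DblMult p u v u v) as [u' v'] eqn:Eu; intros E.
  destruct (DblMult_approx p b b _ _ _ _ _ _ _ _ Hp Du Du Eu Hu Hu) as [Du' Hu'].
  pose proof (IH _ _ _ _ _ _ _ _ _ _ Dh Du' Hh Hu' E) as R.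
  replace (H * U ^ Pos.to_nat j~0) with (H * (U * U) ^ Pos.to_nat j).
  + replace (a + Pos.to_nat j~0 * (b + 1))%nat
      with (a + Pos.to_nat j * (b + b + 1 + 1))%nat by lia.
    exact R.
  + rewrite Pos2Nat.inj_xO, pow_mult.
    replace (U ^ 2) with (U * U) by ring; reflexivity.
- intros E.
  destruct (DblMult_approx p a b _ _ _ _ _ _ _ _ Hp Dh Du E Hh Hu) as [_ R].
  rewrite Pos2Nat.inj_1, pow_1, Nat.mul_1_l, Nat.add_assoc; exact R.
Qed.

(** * From the factor count to a relative error and faithfulness *)

Lemma Bernoulli (d : R) (c : nat) : -1 <= d -> 1 + INR c * d <= (1 + d) ^ c.
Proof.
intros Hd; induction c as [|c IH]; [simpl; lra|].
rewrite S_INR; simpl.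
assert (0 <= INR c) by apply pos_INR.
nra.
Qed.

(** With [w = INR c * eta p], Bernoulli gives the lower side. For the upper side,
    [(1 + eta p)^c * (1 - eta p)^c <= 1] yields [(1 + eta p)^c <= 1 / (1 - w)], and
    [1 / (1 - w) <= 1 + 9/8 * w] when [0 <= 9 * w <= 1]. *)
Lemma approx_rel_error (p : Z) (c : nat) (X Y : R) : (2 <= p)%Z ->
  9 * (INR c * eta p) <= 1 -> approx p c X Y ->
  exists d, X = Y * (1 + d) /\ Rabs d <= 9 / 8 * (INR c * eta p).
Proof.
intros Hp Hc [t [-> [Ht1 Ht2]]].
exists (t - 1); split; [ring|].
destruct (eta_bounds p Hp) as [Heta0 Heta1].
assert (Hlow : 1 - INR c * eta p <= (1 - eta p) ^ c).
{ pose proof (Bernoulli (- eta p) c ltac:(lra)).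
  replace (1 - eta p) with (1 + - eta p) by ring; lra. }
assert (Hprod : (1 + eta p) ^ c * (1 - eta p) ^ c <= 1).
{ rewrite <- Rpow_mult_distr; apply Rle_trans with (1 ^ c).
  - apply pow_incr; split; nra.
  - rewrite pow1; lra. }
assert (0 <= INR c * eta p) by (apply Rmult_le_pos; [apply pos_INR|lra]).
assert (0 < (1 + eta p) ^ c) by (apply pow_lt; lra).
assert ((1 + eta p) ^ c <= 1 + 9 / 8 * (INR c * eta p)).
{ set (w := INR c * eta p) in *; set (q := (1 + eta p) ^ c) in *.
  assert (q * (1 - w) <= 1) by nra.
  nra. }
unfold Rabs; destruct Rcase_abs; lra.
Qed.

Theorem theorem5 (x : R) (n : Z) (hx : is_float 53 x) (hn : (1 <= n <= 2 ^ 49)%Z)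
    (h l : R) (hhl : LogPower 53 x n = (h, l)) :
  faithful 53 (powerRZ x n) (RN 53 (h + l)).
Proof.
assert (F0 : is_float 53 0) by (apply is_float_0; lia).
assert (F1 : is_float 53 1) by (apply (is_float_pow2 53 0); lia).
assert (D : forall f, is_float 53 f -> double_word 53 f 0).
{ intros f Ff; split; [|split]; [assumption..|].
  rewrite Rabs_R0; apply Rmult_le_pos; [apply Rlt_le, pow2_gt0|apply Rabs_pos]. }
destruct n as [|i|i]; try lia; unfold LogPower in hhl; cbn [Z.to_pos] in hhl.
pose proof (LogPower_loop_approx 53 i ltac:(lia) 0 0 1 0 x 0 h l 1 x
  (D 1 F1) (D x hx)) as H.
rewrite !Rplus_0_r, Rmult_1_l, Nat.mul_1_r, Nat.add_0_l in H.
specialize (H (approx_refl _ _) (approx_refl _ _) hhl).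
(* Here [2^49 * 7 * 2^-106 = 7 * 2^-57]. The later factor 9/8 turns 7/8 into 63/64, still strictly
   below the threshold [2^-54] of [faithful_RN]. *)
assert (Hc : INR (Pos.to_nat i) * eta 53 <= 7 / 8 * powerRZ 2 (- 53 - 1)).
{ assert (INR (Pos.to_nat i) <= powerRZ 2 49).
  { rewrite INR_IZR_INZ, positive_nat_Z, pow2_IZR by lia; apply IZR_le; lia. }
  replace (7 / 8 * powerRZ 2 (- 53 - 1)) with (powerRZ 2 49 * eta 53).
  - apply Rmult_le_compat_r; [|assumption].
    apply Rlt_le, eta_bounds; lia.
  - unfold eta; replace (7 / 8) with (7 * powerRZ 2 (-3)) by (simpl; field).
    rewrite <- pow2_add, Rmult_comm, !Rmult_assoc, <- !pow2_add; reflexivity. }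
pose proof (pow2_gt0 (- 53 - 1)) as G0.
assert (G1 : powerRZ 2 (- 53 - 1) <= / 16).
{ replace (/ 16) with (powerRZ 2 (-4)) by (simpl; field); apply pow2_le; lia. }
apply approx_rel_error in H; [|lia|lra].
destruct H as [d [-> Hd]].
change (powerRZ x (Z.pos i)) with (x ^ Pos.to_nat i).
apply faithful_RN; [lia|].
change (Rabs d < powerRZ 2 (- 53 - 1)); lra.
Qed.
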